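(* Let $E$ be a directed graph. If $x$ is an isolated point of the boundary path space $\partial E$ (i.e. $\{x\}$ is open in $\partial E$), then $x$ is either a finite path (in which case $r(x)$ is a sink), an eventually periodic infinite path, or a wandering point.
   Context: $\mathbb{N}$ denotes the nonnegative integers (so $0\in\mathbb{N}$). A directed graph $E=(E^0,E^1,r,s)$ consists of countable sets $E^0$ (vertices), $E^1$ (edges) and functions $r,s:E^1\to E^0$ (range and source). A path of length $n\ge 1$ is a sequence $\mu=\mu_1\cdots\mu_n$ of edges with $r(\mu_i)=s(\mu_{i+1})$ for $1\le i\le n-1$; $s(\mu):=s(\mu_1)$, $r(\mu):=r(\mu_n)$. Vertices are paths of length $0$ with $s(v)=r(v)=v$. $E^*$ is the set of all finite paths (including vertices). $E^\infty$ is the set of infinite paths $x=(x_i)_{i\in\mathbb{N}}$, $x_i\in E^1$, $r(x_i)=s(x_{i+1})$ for all $i\in\mathbb{N}$, with $s(x)=s(x_0)$. For a vertex $v$, $vE^1=\{e\in E^1:s(e)=v\}$. A vertex $v$ is a sink if $vE^1=\emptyset$ and an infinite emitter if $vE^1$ is infinite; $E^0_{\mathrm{sing}}$ is the set of sinks and infinite emitters. The boundary path space is $\partial E:=E^\infty\cup\{\mu\in E^*:r(\mu)\in E^0_{\mathrm{sing}}\}$. For $\mu\in E^*$, $Z(\mu):=\{\mu x\in\partial E: x\in\partial E,\ s(x)=r(\mu)\}$ (concatenation, with $\mu x=x$ if $\mu$ is a vertex, and $\mu x=\mu$ if $x=r(\mu)$ is a vertex), and for a finite set $F\subseteq r(\mu)E^1$,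 $Z(\mu\setminus F):=Z(\mu)\setminus\bigcup_{e\in F}Z(\mu e)$. The topology of $\partial E$ has the sets $Z(\mu\setminus F)$ as a basis; it is locally compact Hausdorff. An infinite path $x\in E^\infty$ is eventually periodic if there are $n,p\in\mathbb{N}$ with $p>0$ such that deleting the first $n+p$ edges of $x$ gives the same infinite path as deleting the first $n$ edges of $x$ (equivalently $x=\mu\gamma\gamma\gamma\cdots$ for some $\mu\in E^*$ and some cycle $\gamma$, i.e. a path $\gamma$ of length at least $1$ with $s(\gamma)=r(\gamma)$). An infinite path $x\in E^\infty$ is a wandering point if $\{n\in\mathbb{N}:s(x_n)=v\}$ is finite for every $v\in E^0$. *)

(* Defs.v *)
From HB Require Import structures.
From mathcomp Require Import all_boot.
From mathcomp Require Import boolp classical_sets functions cardinality.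
From mathcomp Require Import topology.

Set Implicit Arguments.
Unset Strict Implicit.
Unset Printing Implicit Defensive.

Local Open Scope classical_set_scope.

Record digraph := Digraph {
  vertex : countType;
  edge : countType;
  rng : edge -> vertex;
  src : edge -> vertex }.

Section BoundaryPaths.
Variable E : digraph.
Implicit Types (v : vertex E) (e : edge E) (F : set (edge E)).

Definition out_edges v : set (edge E) := [set e | src e = v].

Definition sink v : Prop := out_edges v = set0.

Definition infinite_emitter v : Prop := infinite_set (out_edges v).

Definition singular v : Prop := sink v \/ infinite_emitter v.

(* A finite path is encoded by its source and its sequence of edges, so that
   the vertex [v], seen as a path of length 0, is [(v, [::])].  Membership in
   E^* is [is_fin_path]; arbitrary pairs need not be paths. *)
Definition fin_seq : Type := (vertex E * seq (edge E))%type.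
Implicit Types (mu nu : fin_seq).

Definition is_fin_path mu : bool :=
  (if mu.2 is e :: _ then src e == mu.1 else true) &&
  sorted (fun e f => rng e == src f) mu.2.

Definition fin_range mu : vertex E := last mu.1 [seq rng e | e <- mu.2].

Definition is_inf_path (x : nat -> edge E) : Prop :=
  forall i, rng (x i) = src (x i.+1).

Inductive walk : Type :=
  | Fin of fin_seq
  | Inf of (nat -> edge E).

Definition source (w : walk) : vertex E :=
  match w with Fin mu => mu.1 | Inf x => src (x 0) end.

Definition is_boundary (w : walk) : Prop :=
  match w with
  | Fin mu => is_fin_path mu /\ singular (fin_range mu)
  | Inf x => is_inf_path x
  end.

Record boundary : Type := Boundary {
  walk_of :> walk;
  walk_ofP : is_boundary walk_of }.

HB.instance Definition _ := gen_eqMixin boundary.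
HB.instance Definition _ := gen_choiceMixin boundary.

(* Only meaningful when [source w = fin_range mu]. *)
Definition concat mu (w : walk) : walk :=
  match w with
  | Fin nu => Fin (mu.1, mu.2 ++ nu.2)
  | Inf x => Inf (fun i => if i < size mu.2 then nth (x 0) mu.2 i
                           else x (i - size mu.2))
  end.

Definition extend mu e : fin_seq := (mu.1, rcons mu.2 e).

Definition cylinder mu : set boundary :=
  [set z | exists x : boundary,
     source x = fin_range mu /\ walk_of z = concat mu x].

Definition cylinder_minus mu F : set boundary :=
  cylinder mu `\` \bigcup_(e in F) cylinder (extend mu e).

Definition basic_sets : set (set boundary) :=
  [set B | exists mu F, [/\ is_fin_path mu, finite_set F,
     F `<=` out_edges (fin_range mu) & B = cylinder_minus mu F]].

Lemma fin_range_cat v s t :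
  fin_range (v, s ++ t) = fin_range (fin_range (v, s), t).
Proof. by rewrite /fin_range /= map_cat last_cat. Qed.

Lemma is_fin_path_cons v e s :
  is_fin_path (v, e :: s) = (src e == v) && is_fin_path (rng e, s).
Proof.
by rewrite /is_fin_path /=; case: s => //= f s; rewrite (eq_sym (rng e)).
Qed.

Lemma is_fin_path_cat v s t :
  is_fin_path (v, s ++ t) =
  is_fin_path (v, s) && is_fin_path (fin_range (v, s), t).
Proof.
elim: s v => [|e s IH] v //=.
by rewrite !is_fin_path_cons IH andbA.
Qed.

Lemma source_concat mu w : is_fin_path mu -> source w = fin_range mu ->
  source (concat mu w) = mu.1.
Proof.
case: mu => v [|e s]; case: w => //= x.
by rewrite is_fin_path_cons => /andP[/eqP].
Qed.

Lemma concatA v s t w : concat (v, s ++ t) w = concat (v, s) (concat (fin_range (v, s), t) w).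
Proof.
case: w => [nu|x] /=; first by rewrite catA.
congr Inf; apply/funext => i; rewrite size_cat nth_cat.
have [lis|lsi] := ltnP i (size s).
  by rewrite (leq_trans lis) ?leq_addr//; apply: set_nth_default.
by rewrite -ltn_subLR// subnDA.
Qed.

Lemma is_boundary_concat mu w : is_fin_path mu -> source w = fin_range mu ->
  is_boundary w -> is_boundary (concat mu w).
Proof.
case: mu => v s; elim: s v => [|e s IH] v.
  case: w => [[u t]|x] //= _.
    by rewrite /fin_range /= => ->.
  by move=> _ Hx i; rewrite /= !subn0.
rewrite is_fin_path_cons => /andP[/eqP sev Hs] Hw bw.
have {IH} := IH (rng e) Hs Hw bw.
have := source_concat Hs Hw.
case: w Hw bw => [[u t]|x] /= Hw bw.
  by move=> _ [H1 H2]; split => //; rewrite is_fin_path_cons sev eqxx.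
move=> Hsrc H [|i] /=; last by have := H i; rewrite /= !subSS.
by rewrite -Hsrc subSS.
Qed.

Lemma cylinder_nested mu nu (z : boundary) : is_fin_path mu -> is_fin_path nu ->
  size mu.2 <= size nu.2 -> cylinder mu z -> cylinder nu z ->
  exists t, nu = (mu.1, mu.2 ++ t).
Proof.
move=> Hmu Hnu le_sz [x [sx zx]] [y [sy zy]].
have E1 : nu.1 = mu.1 by rewrite -(source_concat Hmu sx) -zx zy source_concat.
exists (drop (size mu.2) nu.2); case: nu E1 Hnu le_sz sy zy => _ t /= -> _ le_sz _.
rewrite zx; case: (walk_of x) => [p|x']; case: (walk_of y) => [q|y'] //= [].
  move=> /(congr1 (take (size mu.2))); rewrite take_size_cat// takel_cat// => {1}->.
  by rewrite cat_take_drop.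
move=> Exy; congr pair; rewrite -{1}[t](cat_take_drop (size mu.2)); congr (_ ++ _).
apply: (@eq_from_nth _ (x' 0)) => [|i]; rewrite size_takel// => lti.
have := congr1 (@^~ i) Exy; rewrite /= lti (leq_trans lti le_sz) nth_take// => H.
rewrite (set_nth_default (y' 0)) ?(leq_trans lti le_sz)//.
Qed.

Lemma cylinder_sub mu nu (z : boundary) : is_fin_path mu -> is_fin_path nu ->
  size mu.2 <= size nu.2 -> cylinder mu z -> cylinder nu z ->
  cylinder nu `<=` cylinder mu.
Proof.
move=> Hmu Hnu le_sz zm zn.
have [t Et] := cylinder_nested Hmu Hnu le_sz zm zn.
move: Hnu; rewrite Et; case: mu {Hmu le_sz zm Et} => v s /=.
rewrite is_fin_path_cat => /andP[Hs Ht] z' [y [sy zy]].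
move: sy; rewrite fin_range_cat => sy.
exists (Boundary (is_boundary_concat Ht sy (walk_ofP y))) => /=.
by rewrite -concatA (source_concat Ht sy).
Qed.

Lemma is_fin_path_extend mu e : is_fin_path mu -> out_edges (fin_range mu) e ->
  is_fin_path (extend mu e).
Proof.
case: mu => v s Hmu /= se.
by rewrite /extend /= -cats1 is_fin_path_cat Hmu is_fin_path_cons se eqxx.
Qed.

Lemma basic_sets_cover : \bigcup_(B in basic_sets) B = setT.
Proof.
apply/seteqP; split=> // z _.
exists (cylinder_minus (source z, [::]) set0).
  by exists (source z, [::]), set0; split.
split=> [|[]//]; exists z; split=> //.
case: z => -[[v s]|x] //= _; congr Inf; apply/funext => i.
by rewrite subn0.
Qed.

Lemma basic_sets_join (A B : set boundary) (z : boundary) :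
  basic_sets A -> basic_sets B -> A z -> B z ->
  exists C, [/\ basic_sets C, C z & C `<=` A `&` B].
Proof.
move=> [mu [F [Hmu finF sF ->]]] [nu [G [Hnu finG sG ->]]].
wlog le_sz : mu F nu G Hmu Hnu finF finG sF sG / size mu.2 <= size nu.2.
  move=> W zA zB; have [/W|/ltnW/W] := leqP (size mu.2) (size nu.2); first exact.
  by rewrite setIC; apply.
move=> [zmu zF] [znu zG].
have sub := cylinder_sub Hmu Hnu le_sz zmu znu.
have [t Et] := cylinder_nested Hmu Hnu le_sz zmu znu.
case: t Et => [|e t] Et.
  have {}Et : nu = mu by rewrite Et cats0; case: (mu).
  subst nu; exists (cylinder_minus mu (F `|` G)); split.
  - exists mu, (F `|` G); split=> //; first by rewrite finite_setU.
    by move=> e [/sF|/sG].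
  - by split=> // -[e [Fe|Ge] ze]; [apply: zF|apply: zG]; exists e.
  - by move=> z' [z'mu z'FG]; split; split=> // -[e He ze]; apply: z'FG;
      exists e => //; [left|right].
exists (cylinder_minus nu G); split=> //; first by exists nu, G.
move=> z' [z'nu z'G]; split; split=> //; first exact: sub.
move=> [f Ff z'f]; apply: zF; exists f => //.
apply: (cylinder_sub _ Hnu _ z'f z'nu) => //.
  exact: is_fin_path_extend (sF _ Ff).
by rewrite Et /= size_rcons size_cat addnS ltnS leq_addr.
Qed.

HB.instance Definition _ :=
  isBaseTopological.Build boundary basic_sets_cover basic_sets_join.

Definition shift (n : nat) (x : nat -> edge E) : nat -> edge E :=
  fun i => x (n + i).

Definition eventually_periodic (x : nat -> edge E) : Prop :=
  exists n p, 0 < p /\ shift (n + p) x = shift n x.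

Definition wandering (x : nat -> edge E) : Prop :=
  forall v, finite_set [set n | src (x n) = v].

End BoundaryPaths.

(* Main.v *)
Require Import Defs.
From mathcomp Require Import all_boot.
From mathcomp Require Import boolp classical_sets functions cardinality.
From mathcomp Require Import topology.

(** An isolated point [x] is the only element of some basic set [Z(mu \ F)]
    containing it, so the proof consists in modifying [x] far along the path
    without leaving [Z(mu \ F)]: every such modification must give back [x].

    Membership in [Z(mu \ F)] only depends on the first [|mu| + 1] edges, in the
    sense that [Z(mu \ F)] contains [Z(nu)] for every initial segment [nu] of
    [x] longer than [mu] ([cylinder_sub_cylinder_minus]).

    If [x] is a finite path ending at an infinite emitter, then [Z(mu \ F)]
    contains [Z(x e)] for some edge [e]: any edge will do when [x] is longer
    than [mu], and any edge outside the finite set [F] when [x = mu]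
    ([emitter_cylinder_extend]).  Since every vertex is the source of a boundary
    path ([boundary_from]), [Z(x e)] is nonempty, and its elements are longer
    than [x].  So [x] ends at a sink.

    If [x] is an infinite path that is not wandering, some vertex [v] is visited
    at infinitely many times.  Choose two of them [a < b] with [b > |mu|] and run
    once more through the loop [x_a ... x_(b-1)] after reaching time [b]: the
    resulting path [x_0 ... x_(b-1) x_a x_(a+1) ...] shares its first [b] edges
    with [x], hence equals [x], and comparing the tails at time [b] shows that
    [x] has eventual period [b - a]. *)

Local Open Scope classical_set_scope.

Section IsolatedPoints.
Set Implicit Arguments.
Unset Strict Implicit.
Context {E : digraph}.
Implicit Types (v : vertex E) (e : edge E) (mu nu : fin_seq E).
Implicit Types (x z : boundary E) (y : nat -> edge E).

Lemma fin_range_extend mu e : fin_range (extend mu e) = rng e.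
Proof. by case: mu => v s; rewrite /fin_range /= map_rcons last_rcons. Qed.

Definition prefix_path y n : fin_seq E := (src (y 0), mkseq y n).

Lemma fin_range_prefix_path y n : is_inf_path y ->
  fin_range (prefix_path y n) = src (y n).
Proof.
move=> py; case: n => [//|n].
by rewrite /prefix_path mkseqS (fin_range_extend (_, _)) py.
Qed.

Lemma is_fin_path_prefix_path y n : is_inf_path y ->
  is_fin_path (prefix_path y n).
Proof.
move=> py; elim: n => [//|n IH].
rewrite /prefix_path mkseqS.
by apply: is_fin_path_extend IH _ => /=; rewrite fin_range_prefix_path.
Qed.

Lemma concat_prefix_path y y' n :
  concat (prefix_path y n) (Inf y') =
  Inf (fun i => if i < n then y i else y' (i - n)).
Proof.
rewrite /= size_mkseq; congr Inf; apply/funext => i.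
by case: ltnP => // lin; rewrite nth_mkseq.
Qed.

(** If a singular vertex is reachable from [v], a path leading to it is a
    boundary path.  Otherwise every vertex reachable from [v] emits an edge, and
    following a fixed choice of such edges never stops. *)
Lemma boundary_from v : exists x, source x = v.
Proof.
pose reach u := exists mu, [/\ is_fin_path mu, mu.1 = v & fin_range mu = u].
have reach_v : reach v by exists (v, [::]).
have reach_rng e : reach (src e) -> reach (rng e).
  move=> [mu [pmu smu rmu]]; exists (extend mu e).
  by split; rewrite ?fin_range_extend//; apply: is_fin_path_extend.
case: (pselect (exists2 u, reach u & singular u)) => [[u [mu [pmu smu rmu]] su]|].
  have bmu : is_boundary (Fin mu) by rewrite /= rmu.
  by exists (Boundary bmu).
move=> nosing.
have next u : reach u -> exists e, src e = u.
  move=> ru; apply: contrapT => ne; apply: nosing; exists u => //; left.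
  by apply/seteqP; split=> // e eu; case: ne; exists e.
have [e0 _] := next v reach_v.
have /choice[f fP] : forall u, exists e, reach u -> src e = u.
  move=> u; case: (pselect (reach u)) => [/next[e se]|nr]; first by exists e.
  (* [e0] is a junk value for the unreachable vertices *)
  by exists e0.
pose u i := iter i (fun w => rng (f w)) v.
have ru i : reach (u i).
  by elim: i => [//|i IH] /=; apply: reach_rng; rewrite fP.
have bu : is_boundary (Inf (fun i => f (u i))) by move=> i; rewrite fP.
by exists (Boundary bu); rewrite /= fP.
Qed.

Lemma cylinder_concat mu x : is_fin_path mu -> source x = fin_range mu ->
  exists2 z, walk_of z = concat mu x & cylinder mu z.
Proof.
move=> pmu sx.
by exists (Boundary (is_boundary_concat pmu sx (walk_ofP x))) => //; exists x.
Qed.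

Lemma cylinder_nonempty mu : is_fin_path mu -> cylinder mu !=set0.
Proof.
move=> pmu; have [x sx] := boundary_from (fin_range mu).
by have [z _ zmu] := cylinder_concat pmu sx; exists z.
Qed.

Lemma cylinder_extend mu e : is_fin_path (extend mu e) ->
  cylinder (extend mu e) `<=` cylinder mu.
Proof.
case: mu => v s; rewrite /extend /= -cats1 is_fin_path_cat => /andP[ps pe].
move=> z [x [sx zx]]; rewrite fin_range_cat in sx.
have [w wx _] := cylinder_concat pe sx.
exists w; rewrite wx (source_concat pe sx); split=> //.
by rewrite zx concatA.
Qed.

Lemma cylinder_finite x nu : is_fin_path nu -> walk_of x = Fin nu ->
  cylinder nu x.
Proof.
move=> pnu xnu; have := walk_ofP x; rewrite xnu => -[_ sing].
have bx : is_boundary (Fin (fin_range nu, [::])) by [].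
by exists (Boundary bx); rewrite xnu /= cats0; split=> //; case: (nu).
Qed.

Lemma size_cylinder_finite z mu nu : cylinder mu z -> walk_of z = Fin nu ->
  size mu.2 <= size nu.2.
Proof.
by move=> [x [_ ->]]; case: (walk_of x) => //= p [<-]; rewrite size_cat leq_addr.
Qed.

Lemma cylinder_prefix_path x y n : walk_of x = Inf y ->
  cylinder (prefix_path y n) x.
Proof.
move=> xy; have := walk_ofP x; rewrite xy => py.
have bx : is_boundary (Inf (shift n y)) by move=> i; rewrite /shift addnS.
exists (Boundary bx); split; first by rewrite fin_range_prefix_path //= /shift addn0.
rewrite xy concat_prefix_path; congr Inf; apply/funext => i.
by case: ltnP => // nlei; rewrite /shift subnKC.
Qed.

(** For [e] in [F], the path [mu e] is no longer than [nu], so [Z(nu)] is either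
    contained in [Z(mu e)] or disjoint from it; the former is excluded by
    [x]. *)
Lemma cylinder_sub_cylinder_minus mu nu F x : is_fin_path mu -> is_fin_path nu ->
  F `<=` out_edges (fin_range mu) -> size mu.2 < size nu.2 ->
  cylinder_minus mu F x -> cylinder nu x ->
  cylinder nu `<=` cylinder_minus mu F.
Proof.
move=> pmu pnu Fout ltsz [xmu xF] xnu z znu; split.
  exact: (cylinder_sub pmu pnu (ltnW ltsz) xmu xnu znu).
move=> [e Fe ze]; apply: xF; exists e => //.
apply: (cylinder_sub _ pnu _ ze znu xnu).
  exact: is_fin_path_extend (Fout e Fe).
by rewrite /= size_rcons.
Qed.

Lemma cylinder_extend_inj mu e f z : is_fin_path mu ->
  out_edges (fin_range mu) e -> out_edges (fin_range mu) f ->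
  cylinder (extend mu e) z -> cylinder (extend mu f) z -> e = f.
Proof.
move=> pmu oe of_ ze zf.
have [||| t] := cylinder_nested _ _ _ ze zf.
- exact: is_fin_path_extend.
- exact: is_fin_path_extend.
- by rewrite /= !size_rcons.
- case: mu {pmu oe of_ ze zf} => v s [] /(congr1 (drop (size s))).
  by rewrite -!cats1 -catA !drop_size_cat// => -[->].
Qed.

(** Here [mu] is an initial segment of [nu].  If it is a proper one, the longer
    cylinder [Z(nu)] is already contained in [Z(mu \ F)]; if [nu = mu], an edge
    [e] outside of the finite set [F] makes [Z(nu e)] avoid all the removed
    cylinders. *)
Lemma emitter_cylinder_extend mu nu F x : is_fin_path mu -> is_fin_path nu ->
  F `<=` out_edges (fin_range mu) -> finite_set F ->
  infinite_emitter (fin_range nu) ->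
  walk_of x = Fin nu -> cylinder_minus mu F x ->
  exists2 e, out_edges (fin_range nu) e &
             cylinder (extend nu e) `<=` cylinder_minus mu F.
Proof.
move=> pmu pnu Fout finF infnu xnu xmuF; have [xmu xF] := xmuF.
have [e [oe nFe]] := infinite_setN0 (infinite_setD infnu finF).
exists e => //; have pe := is_fin_path_extend pnu oe.
have xcyl := cylinder_finite pnu xnu.
have lesz := size_cylinder_finite xmu xnu.
move: (lesz); rewrite leq_eqVlt => /orP[/eqP eqsz|ltsz]; last first.
  apply: subset_trans (cylinder_extend pe) _.
  exact: cylinder_sub_cylinder_minus xmuF xcyl.
have [t nuE] := cylinder_nested pmu pnu lesz xmu xcyl.
have {}nuE : nu = mu.
  move: eqsz; rewrite nuE /= size_cat => /eqP.
  rewrite -{1}[size _]addn0 eqn_add2l eq_sym size_eq0 => /eqP->.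
  by rewrite cats0; case: (mu).
subst nu => z ze; split; first exact: (cylinder_extend pe ze).
move=> [f Ff zf]; apply: nFe.
by rewrite (cylinder_extend_inj pmu oe (Fout f Ff) ze zf).
Qed.

Lemma isolated_basic x : open [set x] ->
  exists mu F, [/\ is_fin_path mu, finite_set F,
    F `<=` out_edges (fin_range mu) & cylinder_minus mu F = [set x]].
Proof.
move=> [D Dbasic Dx].
have [B DB Bx] : (\bigcup_(B in D) B) x by rewrite Dx.
have [mu [F [pmu finF Fout BE]]] := Dbasic B DB.
exists mu, F; split=> //; rewrite -BE; apply/seteqP; split; last by move=> _ ->.
by rewrite -Dx => z Bz; exists B.
Qed.

(** At an infinite emitter, [x] could be continued by an edge without leaving the
    basic open set that isolates it. *)
Lemma isolated_finite_sink x nu : open [set x] -> walk_of x = Fin nu ->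
  sink (fin_range nu).
Proof.
move=> /isolated_basic[mu [F [pmu finF Fout muFE]]] xnu.
have := walk_ofP x; rewrite xnu => -[pnu [//|infnu]].
have xmuF : cylinder_minus mu F x by rewrite muFE.
have [e oe] := emitter_cylinder_extend pmu pnu Fout finF infnu xnu xmuF.
have [z ze] := cylinder_nonempty (is_fin_path_extend pnu oe).
rewrite muFE => /(_ z ze) /= zx.
by rewrite zx in ze; have := size_cylinder_finite ze xnu; rewrite /= size_rcons ltnn.
Qed.

(** Repeating a loop far enough along the path stays in the basic open set that
    isolates [x], so it must leave [x] unchanged. *)
Lemma isolated_recurrent_periodic x y v : open [set x] -> walk_of x = Inf y ->
  infinite_set [set n | src (y n) = v] -> eventually_periodic y.
Proof.
move=> /isolated_basic[mu [F [pmu finF Fout muFE]]] xy infv.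
have py : is_inf_path y by have := walk_ofP x; rewrite xy.
have visit m : exists2 n, m <= n & src (y n) = v.
  have [n [nv /negP]] := infinite_setN0 (infinite_setD infv (finite_II m)).
  by rewrite -leqNgt; exists n.
have [a _ av] := visit 0.
have [b] := visit (maxn (size mu.2) a).+1.
rewrite gtn_max => /andP[mub ab] bv.
(* the tail [shift a y] may follow the first [b] edges since [y] is at [v] at
   both times; the resulting path goes through the loop twice *)
have pb := is_fin_path_prefix_path b py.
have btail : is_boundary (Inf (shift a y)) by move=> i; rewrite /shift addnS.
have [|z zE zb] := cylinder_concat (x := Boundary btail) pb.
  by rewrite fin_range_prefix_path //= /shift addn0 av.
have zx : z = x.
  suff : [set x] z by [].
  rewrite -muFE; apply: cylinder_sub_cylinder_minus zb => //.
  - by rewrite size_mkseq.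
  - by rewrite muFE.
  - exact: cylinder_prefix_path.
move: zE; rewrite zx xy concat_prefix_path => -[] yE.
exists a, (b - a); split; first by rewrite subn_gt0.
apply/funext => i; rewrite (subnKC (ltnW ab)) [LHS]/shift.
by have := congr1 (@^~ (b + i)) yE; rewrite /= ltnNge leq_addr /= addKn.
Qed.

End IsolatedPoints.

Theorem proposition3p1 (E : digraph) (x : boundary E) (hx : open [set x]) :
  (exists mu : fin_seq E, walk_of x = Fin mu /\ sink (fin_range mu)) \/
  (exists y : nat -> edge E, walk_of x = Inf y /\ eventually_periodic y) \/
  (exists y : nat -> edge E, walk_of x = Inf y /\ wandering y).
Proof.
case xE: (walk_of x) => [mu|y].
  by left; exists mu; split=> //; exact: isolated_finite_sink hx xE.
right; case: (pselect (wandering y)) => [wy|/existsNP[v infv]].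
  by right; exists y.
by left; exists y; split=> //; exact: isolated_recurrent_periodic hx xE infv.
Qed.
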